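(* Let $S$ be a left reversible left cancellative monoid with a finite choice of generators $X$. If $S$ has maximal global cogrowth (with respect to $X$) then $S$ is left amenable.
   Context: A monoid $S$ is left cancellative if $zx=zy$ implies $x=y$. $S$ is left reversible if it does not admit disjoint (non-empty) right ideals. $X^+$ (respectively $X^*$) denotes the free semigroup (free monoid) on $X$, and $|w|$ the length of a word $w$. A finite choice of generators for a semigroup (or monoid) $S$ is a finite set $X$ of symbols together with a surjective morphism from $X^+$ (or from $X^*$) onto $S$, $w\mapsto\overline{w}$. The global cogrowth function $\gamma^{S,X}(n)$ ($n\geq1$) is the number of pairs $(u,v)$ of non-empty words over $X$ with $|u|+|v|=n$ and $\overline{u}=\overline{v}$ in $S$. The global cogrowth rate is $\gamma^{S,X}=\limsup_{n\to\infty}(\gamma^{S,X}(n))^{1/n}\leq|X|$; $S$ has maximal global cogrowth (with respect to $X$) if $\gamma^{S,X}=|X|$. $S$ is left amenable if there is a finitely additive probability measure $\mu$, defined on all subsets of $S$, such that $\mu(a^{-1}Y)=\mu(Y)$ for all $Y\subseteq S$ and $a\in S$, where $a^{-1}Y=\{s\in S: as\in Y\}$. *)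

(* Defs.v *)
From mathcomp Require Import all_boot all_order all_algebra.
From mathcomp Require Import finmap.
From mathcomp Require Import all_classical all_reals all_analysis.

Set Implicit Arguments.
Unset Strict Implicit.
Unset Printing Implicit Defensive.

Local Open Scope classical_set_scope.

Section Monoids.
Variable S : monoidType.
Implicit Types I J : set S.

Definition left_cancellative : Prop :=
  forall x y z : S, (z * x = z * y)%g -> x = y.

Definition right_ideal I : Prop := I !=set0 /\ forall x s, I x -> I (x * s)%g.

Definition left_reversible : Prop :=
  ~ exists I J, [/\ right_ideal I, right_ideal J & I `&` J = set0].

(* The free monoid on X is [seq X] under concatenation. A surjective morphism
   from the free semigroup X^+ onto the monoid S extends to [seq X] by sending
   the empty word to 1, so it is covered by the monoid case below. *)
Record generator_choice (X : finType) := GeneratorChoice {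
  word_val :> seq X -> S;
  word_val_nil : word_val [::] = 1%g;
  word_val_cat : forall u v, word_val (u ++ v) = (word_val u * word_val v)%g;
  word_val_surj : forall s, exists w, word_val w = s
}.

Section Cogrowth.
Variables (X : finType) (phi : generator_choice X).

Definition cogrowth_pairs (n : nat) : set (seq X * seq X) :=
  [set uv | [/\ uv.1 <> [::], uv.2 <> [::], (size uv.1 + size uv.2 = n)%N
              & phi uv.1 = phi uv.2]].

(* [fset_set] is only meaningful on finite sets. *)
Lemma finite_cogrowth_pairs n : finite_set (cogrowth_pairs n).
Proof.
pose f (p : 'I_n.+1 * n.-tuple X) := (take p.1 p.2, drop p.1 p.2).
apply: (@sub_finite_set _ _ (f @` setT)); last first.
  by apply: finite_image; exact: finite_finset.
move=> [u v] [_ _ /= suv _].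
have ltu : (size u < n.+1)%N by rewrite ltnS -suv leq_addr.
have sz : size (u ++ v) == n by rewrite size_cat suv.
exists (Ordinal ltu, Tuple sz) => //.
by rewrite /f /= take_size_cat // drop_size_cat.
Qed.

Definition cogrowth (n : nat) : nat := #|` fset_set (cogrowth_pairs n)|.

(* The limsup is taken in the extended reals, where it always exists; the term
   of index 0, for which n^-1 is a junk value, does not affect it. *)
Definition cogrowth_rate (R : realType) : \bar R :=
  limn_esup (fun n : nat => ((cogrowth n)%:R `^ n%:R^-1)%R%:E).

Definition maximal_cogrowth (R : realType) : Prop :=
  cogrowth_rate R = (#|X|%:R)%R%:E.

End Cogrowth.

Record finitely_additive_probability (R : realType) (mu : set S -> R) : Prop := {
  fap_ge0 : forall A, (0 <= mu A)%R;
  fap_setT : mu [set: S] = 1%R;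
  fap_additive : forall A B, A `&` B = set0 -> mu (A `|` B) = (mu A + mu B)%R
}.

Definition left_amenable (R : realType) : Prop :=
  exists2 mu : set S -> R, finitely_additive_probability mu &
    forall (a : S) (Y : set S), mu [set s | Y (a * s)%g] = mu Y.

End Monoids.

(* Main.v *)
Require Import Defs.
From mathcomp Require Import all_boot all_order all_algebra.
From mathcomp Require Import finmap.
From mathcomp Require Import all_classical all_reals all_analysis.
From mathcomp Require Import ring lra.

(** The number of pairs of equal words is a sum of inner products: if [p_k] is
    the distribution on [S] of a uniformly random word of length [k], then
    [#|X| ^ (i + j) * <p_i, p_j>] counts the pairs of words of lengths [i] and
    [j] with the same value. Let [P] be the average of the left translations by
    the generators, so that [p_{k+1} = P p_k]. Left cancellation makes each
    translation an isometry of the inner product, hence [P] is a contraction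
    and [b_k = <p_k, p_k>] is nonincreasing.

    By Cauchy-Schwarz [<p_i, p_j>^2 <= b_i b_j], so exponential decay of [b]
    would make the cogrowth rate smaller than [#|X|]. Maximal cogrowth thus
    provides, for every [N], some [k] with [b_{k+N} > b_k / 2]
    ([slow_decay_of_maximal_cogrowth]). For such [k] consider
    [F = p_k + ... + p_{k+N-1}]. As [F - P F = p_k - p_{k+N}] telescopes, its
    inner product with [F] is at most [|F| * sqrt b_k], whereas [|F|^2] is at
    least [N b_{k+N} > N b_k / 2] because all inner products of the terms are
    nonnegative. Therefore [<P F, F>] is as close to [|F|^2] as desired
    ([dot_avg_sum_walks]), and since [P] averages isometries, every generator
    moves [F] only a little.

    The function [F^2 / |F|^2] is then the density of a finitely supported
    probability on [S] that is almost invariant under all generators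
    ([almost_invariant_probability]). A limit of such probabilities along an
    ultrafilter is an invariant finitely additive probability
    ([invariant_limit]). *)

Set Implicit Arguments.
Unset Strict Implicit.
Unset Printing Implicit Defensive.

Import Order.TTheory GRing.Theory Num.Theory.
Import numFieldNormedType.Exports.
Local Open Scope classical_set_scope.
Local Open Scope ring_scope.

(** * Finitely supported functions as formal sums *)

Section FormalSums.
Variables (R : realType) (S : monoidType).
Implicit Types (Y Z : set S) (f g h : seq (R * S)) (a s : S) (c : R).

Definition scale c f := [seq (c * p.1, p.2) | p <- f].
Definition translate a f := [seq (p.1, (a * p.2)%g) | p <- f].

(** A list of weighted points stands for the finitely supported function that
    sends [s] to the total weight of [s]; [dot Y] is then the sum over [Y] of
    the product of two such functions. Restricting to a set [Y] lets the same
    form serve both as inner product ([Y = setT]) and, on the diagonal, as the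
    measure with density the square of a function. *)
Definition dot Y f g : R :=
  \sum_(p <- f) \sum_(q <- g) p.1 * q.1 * ((p.2 == q.2) && (p.2 \in Y))%:R.

Lemma dotC Y f g : dot Y f g = dot Y g f.
Proof.
rewrite /dot exchange_big; apply: eq_bigr => q _; apply: eq_bigr => p _.
rewrite [q.1 * _]mulrC eq_sym.
by case: (eqVneq q.2 p.2) => [->|].
Qed.

Lemma dotDl Y f g h : dot Y (f ++ g) h = dot Y f h + dot Y g h.
Proof. exact: big_cat. Qed.

Lemma dotDr Y f g h : dot Y f (g ++ h) = dot Y f g + dot Y f h.
Proof. by rewrite dotC dotDl !(dotC _ f). Qed.

Lemma dotZl Y c f g : dot Y (scale c f) g = c * dot Y f g.
Proof.
rewrite /dot big_map mulr_sumr; apply: eq_bigr => p _.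
by rewrite mulr_sumr; apply: eq_bigr => q _; rewrite !mulrA.
Qed.

Lemma dotZr Y c f g : dot Y f (scale c g) = c * dot Y f g.
Proof. by rewrite dotC dotZl dotC. Qed.

Lemma dot_flattenl Y (I : Type) (r : seq I) (F : I -> seq (R * S)) g :
  dot Y (flatten [seq F i | i <- r]) g = \sum_(i <- r) dot Y (F i) g.
Proof.
elim: r => [|i r IH] /=; first by rewrite /dot !big_nil.
by rewrite dotDl IH big_cons.
Qed.

(** Grouping terms by their point writes [dot Y f f] as a sum of squares of
    total weights, which is why the form is positive semidefinite. *)
Lemma dot_ge0 Y f : 0 <= dot Y f f.
Proof.
pose D := undup [seq p.2 | p <- f].
suff -> : dot Y f f =
    \sum_(s <- D | s \in Y) (\sum_(p <- f) p.1 * (p.2 == s)%:R) ^+ 2.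
  by apply: sumr_ge0 => s _; exact: sqr_ge0.
transitivity (\sum_(s <- D) \sum_(p <- f) \sum_(q <- f)
    p.1 * q.1 * ((p.2 == s) && (q.2 == s) && (s \in Y))%:R); last first.
  rewrite [RHS]big_mkcond /=; apply: eq_bigr => s _.
  case: ifPn => sY; last first.
    by apply: big1 => p _; apply: big1 => q _; rewrite andbF mulr0.
  rewrite expr2 mulr_suml; apply: eq_bigr => p _.
  rewrite mulr_sumr; apply: eq_bigr => q _.
  by rewrite andbT -mulnb natrM; ring.
rewrite exchange_big; apply: eq_big_seq => p pf.
rewrite exchange_big; apply: eq_bigr => q _.
have pD : p.2 \in D by rewrite mem_undup map_f.
rewrite (bigD1_seq p.2) ?undup_uniq //= eqxx /= big1 ?addr0; last first.
  by move=> s /negPf sp; rewrite eq_sym sp mulr0.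
by rewrite eq_sym.
Qed.

Lemma dot_AMGM Y f g : 2 * dot Y f g <= dot Y f f + dot Y g g.
Proof.
have := dot_ge0 Y (f ++ scale (-1) g).
by rewrite !(dotDl, dotDr, dotZl, dotZr) (dotC _ g f); lra.
Qed.

Lemma dot_CauchySchwarz Y f g :
  dot Y f g ^+ 2 <= dot Y f f * dot Y g g.
Proof.
have quad x : 0 <= dot Y g g * x ^+ 2 + (2 * dot Y f g) * x + dot Y f f.
  have := dot_ge0 Y (f ++ scale x g).
  by rewrite !(dotDl, dotDr, dotZl, dotZr) (dotC _ g f); congr (0 <= _); ring.
pose P := Poly [:: dot Y f f; 2 * dot Y f g; dot Y g g].
have sz : (size P <= 3)%N by exact: size_Poly.
have P0 x : 0 <= P.[x].
  by rewrite horner_Poly /=; have := quad x; congr (0 <= _); ring.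
by have := deg_le2_poly_ge0 sz P0; rewrite !coef_Poly /=; nra.
Qed.

Lemma dot_le_setT Y f : dot Y f f <= dot setT f f.
Proof.
suff -> : dot setT f f = dot Y f f + dot (~` Y) f f.
  by rewrite lerDl dot_ge0.
rewrite -big_split /=; apply: eq_bigr => p _.
rewrite -big_split /=; apply: eq_bigr => q _.
rewrite in_setT in_setC; case: (p.2 == q.2) => /=; last by rewrite mulr0 addr0.
by case: (p.2 \in Y) => /=; rewrite ?mulr0 ?addr0 ?add0r.
Qed.

Lemma dotU Y Z f g : Y `&` Z = set0 ->
  dot (Y `|` Z) f g = dot Y f g + dot Z f g.
Proof.
move=> YZ; rewrite -big_split /=; apply: eq_bigr => p _.
rewrite -big_split /=; apply: eq_bigr => q _.
rewrite -mulrDr -natrD in_setU; congr (_ * _%:R).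
have : ~~ ((p.2 \in Y) && (p.2 \in Z)).
  by rewrite -in_setI YZ in_set0.
by case: (_ == _) (p.2 \in Y) (p.2 \in Z) => [] [] [].
Qed.

(** Left cancellation enters here: translation by [a] preserves coincidences of
    points, hence inner products, and pushes the measure with density the square
    of [f] forward along left multiplication by [a]. *)
Lemma dot_translate Y a f g : left_cancellative S ->
  dot Y (translate a f) (translate a g) = dot [set s | Y (a * s)%g] f g.
Proof.
move=> lc; rewrite /dot big_map; apply: eq_bigr => p _.
rewrite big_map; apply: eq_bigr => q _ /=; congr (_ * (_ && _)%:R).
by apply/eqP/eqP => [/lc//|->].
Qed.

Lemma dot_nneg Y f g : {in f, forall p, 0 <= p.1} -> {in g, forall p, 0 <= p.1} ->
  0 <= dot Y f g.
Proof.
move=> f0 g0; rewrite /dot big_seq; apply: sumr_ge0 => p /f0 p0.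
by rewrite big_seq; apply: sumr_ge0 => q /g0 q0; rewrite !mulr_ge0.
Qed.

End FormalSums.

(** * The averaging operator and the random walk *)

Section Walk.
Variables (R : realType) (S : monoidType) (X : finType).
Variables (phi : generator_choice S X).
Hypothesis lc : left_cancellative S.
Implicit Types (Y : set S) (f g h : seq (R * S)) (x : X) (k : nat).

Fixpoint words k : seq (seq X) :=
  if k is k'.+1 then [seq x :: w | x <- enum X, w <- words k'] else [:: [::]].

Lemma mem_words k (w : seq X) : size w = k -> w \in words k.
Proof.
elim: k w => [|k IH] [|x w] //= [sw]; apply/allpairsP.
by exists (x, w); split; rewrite ?mem_enum ?IH.
Qed.

Definition avg f : seq (R * S) :=
  flatten [seq scale #|X|%:R^-1 (translate (phi [:: x]) f) | x <- enum X].

Definition walk k : seq (R * S) :=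
  [seq (#|X|%:R^-1 ^+ k, phi w) | w <- words k].

Lemma walkS k : walk k.+1 = avg (walk k).
Proof.
rewrite /walk /avg /= map_flatten -map_comp; congr flatten.
apply: eq_map => x /=; rewrite /scale /translate -!map_comp.
by apply: eq_map => w /=; rewrite exprS -cat1s word_val_cat.
Qed.

Lemma walk_nneg k : {in walk k, forall p, 0 <= p.1}.
Proof. by move=> p /mapP[w _ ->]; rewrite exprn_ge0 ?invr_ge0. Qed.

Lemma dot_avgl Y f h :
  dot Y (avg f) h = #|X|%:R^-1 * \sum_x dot Y (translate (phi [:: x]) f) h.
Proof.
rewrite dot_flattenl big_enum /= mulr_sumr; apply: eq_bigr => x _.
exact: dotZl.
Qed.

Lemma dot_avg_flatten Y (I : Type) (r : seq I) (G : I -> seq (R * S)) h :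
  dot Y (avg (flatten [seq G i | i <- r])) h = \sum_(i <- r) dot Y (avg (G i)) h.
Proof.
rewrite dot_avgl; under [RHS]eq_bigr do rewrite dot_avgl.
rewrite -mulr_sumr exchange_big; congr (_ * _); apply: eq_bigr => x _.
by rewrite /translate map_flatten -map_comp dot_flattenl.
Qed.

Lemma dot_translateT (a : S) f :
  dot setT (translate a f) (translate a f) = dot setT f f.
Proof. by rewrite dot_translate. Qed.

(** With [g] the average of [f], [|g|^2] is an average of inner products of [g]
    with translates of [f], each at most [(|f|^2 + |g|^2) / 2]. *)
Lemma dot_avg_le f : dot setT (avg f) (avg f) <= dot setT f f.
Proof.
set g := avg f.
suff : dot setT g g <= (dot setT f f + dot setT g g) / 2 by lra.
rewrite [leLHS]dot_avgl.
have [->|X0] := posnP #|X|.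
  by rewrite invr0 mul0r divr_ge0 // addr_ge0 ?dot_ge0.
rewrite ler_pdivrMl ?ltr0n // mulr_natl -[leRHS]/(_ *+ #|X|).
rewrite -sumr_const; apply: ler_sum => x _.
by have := dot_AMGM setT (translate (phi [:: x]) f) g; rewrite dot_translateT; lra.
Qed.

Lemma dot_walk_noninc i j : (i <= j)%N ->
  dot setT (walk j) (walk j) <= dot setT (walk i) (walk i).
Proof.
move=> /subnK <-; elim: (j - i)%N => // d IH.
by apply: le_trans IH; rewrite addSn walkS dot_avg_le.
Qed.

Lemma dot_walk0 : dot setT (walk 0) (walk 0) = 1.
Proof. by rewrite /dot /walk /= !big_seq1 /= eqxx in_setT expr0 !mulr1. Qed.

(** The difference between [F] and its average telescopes to two terms, while
    the squared norm of [F] grows at least linearly in [N]. *)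
Lemma dot_avg_sum_walks k N : (0 < N)%N ->
  dot setT (walk k) (walk k) < 2 * dot setT (walk (k + N)) (walk (k + N)) ->
  let F := flatten [seq walk (k + j) | j <- index_iota 0 N] in
  0 < dot setT F F /\
  N%:R * (dot setT F F - dot setT (avg F) F) ^+ 2 <= 2 * dot setT F F ^+ 2.
Proof.
move=> N0 slow F; set E := dot setT F F.
have F0 : {in F, forall p, 0 <= p.1}.
  by move=> p /flattenP[f /mapP[j _ ->]]; exact: walk_nneg.
have dF h : dot setT F h = \sum_(0 <= j < N) dot setT (walk (k + j)) h.
  exact: dot_flattenl.
(* Off-diagonal terms are nonnegative, and by monotonicity each diagonal one is
   at least the squared norm of [walk (k + N)]. *)
have bE : N%:R * dot setT (walk (k + N)) (walk (k + N)) <= E.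
  rewrite /E dF big_mkord.
  rewrite mulr_natl -[X in _ *+ X]card_ord -sumr_const; apply: ler_sum => j _.
  rewrite dotC dF big_mkord (bigD1 j) //= ler_wpDr //.
    by apply: sumr_ge0 => i _; apply: dot_nneg; exact: walk_nneg.
  by rewrite dot_walk_noninc // leq_add2l ltnW.
have N0R : 1 <= N%:R :> R by rewrite ler1n.
have b0 := dot_ge0 setT (walk k).
have E0 : 0 < E by nra.
split => //.
have diffE : E - dot setT (avg F) F =
    dot setT (walk k) F - dot setT (walk (k + N)) F.
  rewrite /E dF dot_avg_flatten -sumrB.
  under eq_bigr do rewrite -walkS -addnS.
  rewrite -[LHS]opprK -sumrN; under eq_bigr do rewrite opprB.
  by rewrite (telescope_sumr (fun j => dot setT (walk (k + j)) F)) // opprB addn0.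
have d0 : 0 <= dot setT (walk (k + N)) F by apply: dot_nneg F0; exact: walk_nneg.
(* The average is a contraction, so Cauchy-Schwarz bounds this inner product. *)
have dE : 0 <= E - dot setT (avg F) F.
  have := dot_CauchySchwarz setT (avg F) F; have := dot_avg_le F.
  rewrite -/E => le1 le2; rewrite subr_ge0 real_leNgt ?num_real //.
  by apply/negP => lt; nra.
have := dot_CauchySchwarz setT (walk k) F; rewrite -/E.
rewrite diffE in dE *.
set u := dot _ _ F in dE *; set v := dot _ _ F in d0 dE *.
set b := dot _ _ _ in slow b0 *; set c := dot _ _ _ in slow bE.
move=> cs.
(* Both [v] and [u - v] are nonnegative, so [u - v] lies between [0] and [u]. *)
have : (u - v) ^+ 2 <= b * E by apply: le_trans cs; nra.
have : N%:R * b <= 2 * E by nra.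
by nra.
Qed.

End Walk.

(** * Elementary estimates on sequences *)

Section Sequences.
Variable R : realType.

Lemma bernoulli_ineq (h : R) n : 0 <= h -> 1 + n%:R * h <= (1 + h) ^+ n.
Proof.
move=> h0; elim: n => [|n IH]; first by rewrite expr0 mul0r addr0.
have n0 : 0 <= n%:R :> R by [].
by rewrite exprS -natr1; nra.
Qed.

(** Bernoulli's inequality bounds [n.+1 * t ^+ n]; squaring it and dividing by
    [n.+1] makes the product tend to [0]. *)
Lemma eventually_geometric_absorbs_linear (t : R) : 0 < t < 1 ->
  exists n0, forall n, (n0 <= n)%N -> 2 * n.+1%:R * t ^+ (2 * n) <= 1.
Proof.
move=> /andP[t0 t1]; pose h := t^-1 - 1.
have h0 : 0 < h by rewrite subr_gt0 invf_gt1.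
pose C := 1 + h^-1.
have hC : h^-1 * h = 1 by rewrite mulVf ?gt_eqF.
have C0 : 0 < C by rewrite addr_gt0 ?invr_gt0.
have linear n : n.+1%:R * t ^+ n <= C.
  have : n.+1%:R <= C * t^-1 ^+ n.
    have := bernoulli_ineq n (ltW h0); rewrite (_ : 1 + h = t^-1); last first.
      by rewrite /h addrC subrK.
    have n0 : 0 <= n%:R :> R by [].
    have h'0 : 0 < h^-1 by rewrite invr_gt0.
    move=> /(ler_wpM2l (ltW C0)); apply: le_trans.
    have -> : C * (1 + n%:R * h) = 1 + h^-1 + n%:R * h + n%:R * (h^-1 * h).
      by rewrite /C; ring.
    rewrite hC -natr1; nra.
  by rewrite exprVn ler_pdivlMr ?exprn_gt0.
exists (Num.truncn (2 * C ^+ 2)) => n n0.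
have big : 2 * C ^+ 2 <= n.+1%:R.
  by apply: le_trans (ltW (truncnS_gt _)) _; rewrite ler_nat.
have pos : 0 < n.+1%:R :> R by [].
rewrite -(ler_pM2l pos) mulr1 (le_trans _ big) //.
have -> : n.+1%:R * (2 * n.+1%:R * t ^+ (2 * n)) = 2 * (n.+1%:R * t ^+ n) ^+ 2.
  by rewrite mulnC exprM; ring.
rewrite ler_pM2l // lerXn2r // nnegrE ?mulr_ge0 ?exprn_ge0 // ltW //.
Qed.

Lemma exists_root_of_half N : (0 < N)%N ->
  exists2 t : R, 0 < t < 1 & t ^+ N = 2^-1.
Proof.
move=> N0; have h0 : 0 < 2^-1 :> R by rewrite invr_gt0.
have N0R : N%:R != 0 :> R by rewrite pnatr_eq0 -lt0n.
exists (2^-1 `^ N%:R^-1).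
  rewrite powR_gt0 //= -[ltRHS](congr1 (@^~ N%:R^-1) (@powR1 R)).
  apply: gt0_ltr_powR; rewrite ?nnegrE ?invr_gt0 ?ltr0n ?invr_ge0 //.
  by rewrite invf_lt1 // ltr1n.
by rewrite -powR_mulrn ?powR_ge0 // -powRrM mulVf // powRr1 // ltW.
Qed.

Lemma decay_of_halving (b : nat -> R) (r : R) N : 0 < r <= 1 ->
  r ^+ N = 2^-1 -> (forall k, b k <= 1) -> (forall k, 2 * b (k + N)%N <= b k) ->
  forall k, b k <= 2 * r ^+ k.
Proof.
move=> /andP[r0 r1] rN b1 half.
have N0 : (0 < N)%N.
  by case: N rN {half} => // /eqP; rewrite expr0; lra.
elim/ltn_ind => k IH; case: (ltnP k N) => kN.
  apply: le_trans (b1 k) _.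
  by have := ler_wiXn2l (ltW r0) r1 (ltnW kN); rewrite rN; lra.
have := half (k - N)%N; rewrite subnK // => bk.
have := IH (k - N)%N; rewrite ltn_subrL N0 (leq_trans N0 kN) => /(_ isT) bkN.
by rewrite -[in leRHS](subnK kN) exprD rN; lra.
Qed.

End Sequences.

(** * Cogrowth as a sum of inner products *)

Section Cogrowth.
Variables (R : realType) (S : monoidType) (X : finType).
Variables (phi : generator_choice S X).
Hypothesis lc : left_cancellative S.
Hypothesis X0 : (0 < #|X|)%N.
Local Notation walk := (walk R phi).

Lemma dot_walkE i j : dot setT (walk i) (walk j) = #|X|%:R^-1 ^+ (i + j) *
  \sum_(u <- words X i) \sum_(v <- words X j) (phi u == phi v)%:R.
Proof.
rewrite /dot big_map mulr_sumr; apply: eq_bigr => u _.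
rewrite big_map mulr_sumr; apply: eq_bigr => v _ /=.
by rewrite in_setT andbT exprD.
Qed.

(** The right-hand side also counts the pairs with an empty component, whence an
    inequality. *)
Lemma cogrowth_le_dot n : (cogrowth phi n)%:R <=
  #|X|%:R ^+ n * \sum_(i < n.+1) dot setT (walk i) (walk (n - i)).
Proof.
pose L i := [seq uv <- [seq (u, v) | u <- words X i, v <- words X (n - i)]
            | phi uv.1 == phi uv.2].
have sizeL i : (i < n.+1)%N ->
    (size (L i))%:R = #|X|%:R ^+ n * dot setT (walk i) (walk (n - i)) :> R.
  rewrite ltnS => /subnKC ni; rewrite dot_walkE ni exprVn.
  rewrite mulVKf ?expf_neq0 ?pnatr_eq0 -?lt0n //.
  rewrite size_filter -sum1_count natr_sum big_mkcond /= big_allpairs.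
  by apply: eq_bigr => u _; apply: eq_bigr => v _ /=; case: (_ == _).
have cover : {subset fset_set (cogrowth_pairs phi n) <=
    flatten [seq L i | i <- iota 0 n.+1]}.
  move=> [u v]; rewrite in_fset_set; last exact: finite_cogrowth_pairs.
  rewrite inE => -[_ _]; rewrite [_.1]/= [_.2]/= => suv uv.
  apply/flattenP; exists (L (size u)).
    by apply: map_f; rewrite mem_iota leq0n add0n ltnS -suv leq_addr.
  rewrite mem_filter /= uv eqxx /=; apply/allpairsP; exists (u, v).
  by split; rewrite //= mem_words // -suv addKn.
have := uniq_leq_size (fset_uniq _) cover; rewrite -(ler_nat R) => /le_trans; apply.
rewrite size_flatten /shape -map_comp sumnE big_map natr_sum mulr_sumr.
rewrite -[iota _ _]/(index_iota 0 n.+1) big_mkord; apply: ler_sum => i _.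
by rewrite sizeL.
Qed.

Lemma cogrowth_rate_le (q : R) n0 : 0 <= q ->
  (forall n, (n0 <= n)%N -> (cogrowth phi n)%:R <= q ^+ n) ->
  (cogrowth_rate phi R <= q%:E)%E.
Proof.
move=> q0 le_q; rewrite /cogrowth_rate /limn_esup limf_esupE.
(* Starting at [1] avoids the meaningless exponent at index [0]. *)
apply: le_trans (ereal_inf_lbound _) _.
  by exists [set n | (maxn 1 n0 <= n)%N] => //; exact: nbhs_infty_ge.
apply: ge_ereal_sup => _ [n /= ltn <-]; rewrite lee_fin.
move: ltn; rewrite geq_max => /andP[n1 /le_q le_qn].
have n0R : n%:R != 0 :> R by rewrite pnatr_eq0 -lt0n.
apply: le_trans (ge0_ler_powR _ _ _ le_qn) _;
  rewrite ?nnegrE ?invr_ge0 ?exprn_ge0 //.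
by rewrite -powR_mulrn // -powRrM mulfV // powRr1.
Qed.

(** Otherwise the squared norms halve every [N] steps, so by Cauchy-Schwarz all
    the inner products that add up to the cogrowth decay exponentially in the
    total length. *)
Lemma slow_decay_of_maximal_cogrowth N : (0 < N)%N -> maximal_cogrowth phi R ->
  exists k, dot setT (walk k) (walk k) <
            2 * dot setT (walk (k + N)) (walk (k + N)).
Proof.
move=> N0 max; apply: contrapT => /forallNP no_k.
have half k : 2 * dot setT (walk (k + N)) (walk (k + N)) <=
    dot setT (walk k) (walk k) by rewrite leNgt; apply/negP.
(* The sixth power leaves, after the square root of Cauchy-Schwarz, two factors
   [t ^+ n] to absorb the number of splittings of [n] and one to spare. *)
have [|t /andP[t0 t1] tN] := @exists_root_of_half R (6 * N)%N.
  by rewrite muln_gt0.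
have decay : forall k, dot setT (walk k) (walk k) <= 2 * (t ^+ 6) ^+ k.
  apply: (@decay_of_halving R (fun k => dot setT (walk k) (walk k)) _ N) => //.
  - by rewrite exprn_gt0 //= exprn_ile1 // ltW.
  - by rewrite -exprM.
  - move=> k; rewrite -(dot_walk0 R phi); exact: dot_walk_noninc.
have cross i j : dot setT (walk i) (walk j) <= 2 * t ^+ (3 * (i + j)).
  have t3 : 0 <= 2 * t ^+ (3 * (i + j)) by rewrite mulr_ge0 ?exprn_ge0 ?ltW.
  rewrite -(ler_pXn2r (ltn0Sn 1)) ?nnegrE //; last first.
    by apply: dot_nneg; exact: walk_nneg.
  apply: le_trans (dot_CauchySchwarz _ _ _) _.
  apply: le_trans (ler_pM (dot_ge0 _ _) (dot_ge0 _ _) (decay i) (decay j)) _.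
  rewrite le_eqVlt; apply/orP; left; apply/eqP.
  by rewrite mulrACA -(exprD (t ^+ 6)) -exprM !(mulnC _ (i + j)%N) !exprM; ring.
have [|n0 absorb] := @eventually_geometric_absorbs_linear R t.
  by rewrite t0.
have m0 : 0 < #|X|%:R :> R by rewrite ltr0n.
suff : (cogrowth_rate phi R <= (#|X|%:R * t)%:E)%E.
  by rewrite max lee_fin leNgt gtr_pMr // t1.
apply: (@cogrowth_rate_le _ n0); first by rewrite mulr_ge0 ?ltW.
move=> n /absorb abs_n; apply: le_trans (cogrowth_le_dot n) _.
rewrite exprMn ler_pM2l ?exprn_gt0 //.
have : 2 * n.+1%:R * t ^+ (2 * n) * t ^+ n <= t ^+ n.
  by rewrite ger_pMl ?exprn_gt0.
apply: le_trans.
have -> : 2 * n.+1%:R * t ^+ (2 * n) * t ^+ n = (2 * t ^+ (3 * n)) *+ n.+1.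
  by rewrite (mulSn 2 n) exprD -mulr_natr; ring.
rewrite -[X in _ *+ X]card_ord -sumr_const.
apply: ler_sum => i _; apply: le_trans (cross _ _) _.
by rewrite subnKC // -ltnS.
Qed.

End Cogrowth.

(** * Limits of almost invariant probabilities *)

Lemma ultra_fmap (T U : Type) (F : set_system T) (f : T -> U) :
  UltraFilter F -> UltraFilter (f @ F).
Proof.
move=> FU; split=> [|G GP FG]; first exact: fmap_proper_filter.
apply/seteqP; split=> // A GA.
case: (in_ultra_setVsetC (f @^-1` A) FU) => // FnA.
have /filter_ex [x []] : G (A `&` ~` A) by apply: filterI => //; exact: FG.
by [].
Qed.

Section Limit.
Variables (R : realType) (S : monoidType).

Lemma fap_le1 (mu : set S -> R) Y : finitely_additive_probability mu -> mu Y <= 1.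
Proof.
move=> muP; rewrite -(fap_setT muP) -(setUv Y) (fap_additive muP) ?setICr //.
by rewrite lerDl (fap_ge0 muP).
Qed.

(** Each set is given the limit of its probabilities along one ultrafilter on
    [nat]: it exists by compactness of the unit interval, and limits preserve
    additivity and turn vanishing defects of invariance into invariance. *)
Lemma invariant_limit (A : set S) :
  (forall e : R, 0 < e -> exists2 mu : set S -> R,
    finitely_additive_probability mu &
    forall a, A a -> forall Y, `|mu [set s | Y (a * s)%g] - mu Y| <= e) ->
  exists2 mu : set S -> R, finitely_additive_probability mu &
    forall a, A a -> forall Y, mu [set s | Y (a * s)%g] = mu Y.
Proof.
move=> approx.
have /choice[mu_ mu_P] (n : nat) : exists mu : set S -> R,
    finitely_additive_probability mu /\
    forall a, A a -> forall Y,
      `|mu [set s | Y (a * s)%g] - mu Y| <= n.+1%:R^-1.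
  by have [|mu ? ?] := approx n.+1%:R^-1; [rewrite invr_gt0 | exists mu].
have [U [UU ooU]] := @ultraFilterLemma nat \oo _.
pose mu (Y : set S) : R := lim (mu_ ^~ Y @ U).
have cvg_mu Y : mu_ ^~ Y @ U --> mu Y.
  have FU := ultra_fmap (mu_ ^~ Y) UU.
  have := @segment_compact R 0 1; rewrite compact_ultra => /(_ _ FU)[].
    apply: (@filterE _ U) => n /=; have [muP _] := mu_P n.
    by rewrite in_itv /= (fap_ge0 muP) fap_le1.
  by move=> p [_ /cvgP].
exists mu; first split.
- by move=> Y; apply: limr_ge; [exact: cvgP (cvg_mu Y) | apply: filterE => n;
     exact: fap_ge0 (mu_P n).1 _].
- have := cvg_mu setT; under eq_fun do rewrite (fap_setT (mu_P _).1).
  by move=> /(cvg_lim (@Rhausdorff R)) <-; exact: lim_cst.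
- move=> Y Z YZ; rewrite -(cvg_lim (@Rhausdorff R) (cvg_mu _)).
  apply: cvg_lim => //.
  under eq_fun do rewrite (fap_additive (mu_P _).1 YZ).
  exact: cvgD.
move=> a Aa Y; apply/eqP; rewrite -subr_eq0; apply/eqP.
rewrite -(cvg_lim (@Rhausdorff R) (cvgB (cvg_mu _) (cvg_mu _))).
apply: cvg_lim => //.
have harm : @harmonic R @ U --> 0.
  exact: cvg_trans (cvg_app _ ooU) cvg_harmonic.
apply: (@squeeze_cvgr _ _ _ _ (fun n => - harmonic n) (@harmonic R)) => //.
  by apply: filterE => n; rewrite -ler_norml; exact: (mu_P n).2.
by have := @cvgN _ _ _ U _ _ _ harm; rewrite oppr0; exact.
Qed.

Lemma left_amenable_of_generators (X : finType) (phi : generator_choice S X)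
    (mu : set S -> R) : finitely_additive_probability mu ->
  (forall x Y, mu [set s | Y (phi [:: x] * s)%g] = mu Y) -> left_amenable S R.
Proof.
move=> muP inv; exists mu => // a Y.
have [w <-] := word_val_surj phi a.
elim: w Y => [|x w IH] Y.
  by congr mu; apply/funext => s /=; rewrite word_val_nil mul1g.
rewrite -[RHS](inv x) -[RHS]IH; congr mu.
by apply/funext => s /=; rewrite -cat1s word_val_cat mulgA.
Qed.

Lemma left_amenable_trivial : (forall s : S, s = 1%g) -> left_amenable S R.
Proof.
move=> triv; exists (fun Y => (1%g \in Y)%:R).
  split=> [A||A B AB]; first exact: ler0n.
    by rewrite in_setT.
  rewrite -natrD in_setU; congr _%:R.
  have : ~~ ((1%g \in A) && (1%g \in B)) by rewrite -in_setI AB in_set0.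
  by case: (1%g \in A) (1%g \in B) => [] [].
by move=> a Y; congr (_ \in _)%:R; apply/funext => s /=; rewrite (triv a) mul1g.
Qed.

End Limit.

(** * From almost maximal vectors to almost invariant probabilities *)

Section AlmostInvariant.
Variables (R : realType) (S : monoidType) (X : finType).
Variables (phi : generator_choice S X).
Hypothesis lc : left_cancellative S.
Hypothesis X0 : (0 < #|X|)%N.

(** The difference of the squares of [translate a f] and [f] is the product of
    their difference and their sum. Cauchy-Schwarz on [Y] reduces it to the
    inner product of the difference with itself, which the isometry property
    expresses through [dot setT (translate a f) f]. *)
Lemma dot_translate_diff (f : seq (R * S)) (a : S) (Y : set S) :
  (dot [set s | Y (a * s)%g] f f - dot Y f f) ^+ 2 <=
  8 * dot setT f f * (dot setT f f - dot setT (translate a f) f).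
Proof.
set E := dot setT f f; set g := translate a f.
pose diff := g ++ scale (-1) f; pose sum := g ++ f.
have factor : dot [set s | Y (a * s)%g] f f - dot Y f f = dot Y diff sum.
  rewrite -(dot_translate Y a) // -/g /diff /sum !(dotDl, dotDr, dotZl) (dotC Y f g).
  by ring.
have gE : dot setT g g = E by rewrite dot_translate.
have diffE : dot setT diff diff = 2 * (E - dot setT g f).
  rewrite /diff !(dotDl, dotDr, dotZl, dotZr) (dotC _ f g) gE -/E; ring.
have sumE : dot setT sum sum <= 4 * E.
  have := dot_AMGM setT g f.
  by rewrite /sum !(dotDl, dotDr) (dotC _ f g) gE -/E; lra.
rewrite factor; apply: le_trans (dot_CauchySchwarz _ _ _) _.
have leY := ler_pM (dot_ge0 Y diff) (dot_ge0 Y sum) (dot_le_setT Y diff)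
  (le_trans (dot_le_setT Y sum) sumE).
by apply: le_trans leY _; rewrite diffE; lra.
Qed.

(** The summands whose average is [dot setT f f - dot setT (avg phi f) f] are
    all nonnegative, so each is at most their sum. *)
Lemma translate_le_avg (f : seq (R * S)) x :
  dot setT f f - dot setT (translate (phi [:: x]) f) f <=
  #|X|%:R * (dot setT f f - dot setT (avg phi f) f).
Proof.
have n0 : #|X|%:R != 0 :> R by rewrite pnatr_eq0 -lt0n.
rewrite dot_avgl mulrBr mulVKf // mulr_natl -[X in X - _ <= _]/(dot _ _ _).
rewrite -sumr_const -sumrB (bigD1 x) //= lerDl; apply: sumr_ge0 => y _.
by have := dot_AMGM setT (translate (phi [:: y]) f) f; rewrite dot_translateT //; lra.
Qed.

Lemma almost_invariant_probability (e : R) : 0 < e -> maximal_cogrowth phi R ->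
  exists2 mu : set S -> R, finitely_additive_probability mu &
    forall x Y, `|mu [set s | Y (phi [:: x] * s)%g] - mu Y| <= e.
Proof.
move=> e0 max.
have m0 : 0 < #|X|%:R :> R by rewrite ltr0n.
(* [d] is the defect that the two previous lemmas turn into exactly [e ^+ 2]. *)
pose d := e ^+ 2 / (8 * #|X|%:R).
have d0 : 0 < d by rewrite divr_gt0 ?exprn_gt0 ?mulr_gt0.
pose N := (Num.truncn (2 / d ^+ 2)).+1.
have Nd : 2 <= N%:R * d ^+ 2.
  by rewrite -ler_pdivrMr ?exprn_gt0 // ltW // truncnS_gt.
have [k slow] := slow_decay_of_maximal_cogrowth lc X0 (ltn0Sn _ : (0 < N)%N) max.
have [] := dot_avg_sum_walks lc (ltn0Sn _ : (0 < N)%N) slow.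
set F := flatten _; set E := dot _ F F => E0 avgF.
have N0 : 0 < N%:R :> R by [].
have {}avgF : E - dot setT (avg phi F) F <= d * E.
  have : (E - dot setT (avg phi F) F) ^+ 2 <= (d * E) ^+ 2.
    rewrite -(ler_pM2l N0); apply: le_trans avgF _.
    by rewrite exprMn [leRHS]mulrA ler_pM2r ?exprn_gt0.
  have : 0 < d * E by rewrite mulr_gt0.
  by nra.
exists (fun Y => dot Y F F / E).
  split=> [A||A B AB]; first by rewrite divr_ge0 ?dot_ge0 ?ltW.
    by rewrite divff ?gt_eqF.
  by rewrite dotU // mulrDl.
move=> x Y; rewrite -mulrBl normrM (gtr0_norm (_ : 0 < E^-1)) ?invr_gt0 //.
rewrite ler_pdivrMr // -(ler_pXn2r (ltn0Sn 1));
  rewrite ?nnegrE ?mulr_ge0 ?(ltW e0) ?(ltW E0) //.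
rewrite real_normK ?num_real //; apply: le_trans (dot_translate_diff _ _ _) _.
have translateF := le_trans (translate_le_avg F x) (ler_wpM2l (ltW m0) avgF).
apply: le_trans (ler_wpM2l _ translateF) _; first by rewrite mulr_ge0 ?(ltW E0).
rewrite le_eqVlt; apply/orP; left; apply/eqP.
by rewrite /d -/E; field; rewrite gt_eqF.
Qed.

End AlmostInvariant.

(** * Amenability *)

Theorem corollary6p15 (R : realType) (S : monoidType) (X : finType)
  (phi : generator_choice S X) :
  left_reversible S -> left_cancellative S ->
  maximal_cogrowth phi R -> left_amenable S R.
Proof.
move=> _ lc max; have [X0|X0] := posnP #|X|.
  apply: left_amenable_trivial => s; have [[|x w] <-] := word_val_surj phi s.
    exact: word_val_nil.
  by have := card0_eq X0 x.
have [|mu muP inv] := @invariant_limit R S (range (fun x => phi [:: x])).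
  move=> e e0; have [mu muP inv] := almost_invariant_probability lc X0 e0 max.
  by exists mu => // _ [x _ <-]; exact: inv.
by apply: (left_amenable_of_generators (phi := phi) muP) => x Y; apply: inv; exists x.
Qed.
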